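(* Let $r\ge 1$, let $\gamma=(\phi_1,\dots,\phi_r)$ be a separated system of $r$ polynomials with integer coefficients which is not comprised of a single linear polynomial (i.e. it is not the case that $r=1$ and $\deg\phi_1=1$). Let $s\in\mathbb{N}$ and $p=2-\frac1s$, with dual exponent $p'$ defined by $\frac1p+\frac1{p'}=1$. Then there exists a positive constant $C_{p,\gamma}$, depending only on $p$ and $\gamma$, such that for every finite nonempty subset $\mathcal{X}\subseteq\mathbb{N}$ and every interval $I\subset\mathbb{Z}$ containing $\mathcal{X}$, $$\|\mathcal{A}^{\gamma}_{\mathcal{X}}\|_{\ell^{p,1}(\mathbb{Z}^r)\to\ell^{p',\infty}(\mathbb{Z}^r)}\le C_{p,\gamma}\,|\mathcal{X}|^{-1}\Big(|\mathcal{X}|^{s-1}+|\mathcal{X}|\cdot\mathcal{M}^{\gamma}_{s-1}(\mathcal{X},I)\Big)^{\frac1{2s-1}}.$$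
   Context: $\mathbb{N}=\{1,2,3,\dots\}$; $|\cdot|$ of a finite set is its cardinality. A separated system of $r$ polynomials is a tuple $\gamma(T)=(\phi_1(T),\dots,\phi_r(T))$ of polynomials in $\mathbb{Z}[T]$ with $1\le\deg\phi_1<\deg\phi_2<\cdots<\deg\phi_r$. For a finite nonempty set $\mathcal{X}\subset\mathbb{N}$ and $f:\mathbb{Z}^r\to\mathbb{C}$, define $$\mathcal{A}^{\gamma}_{\mathcal{X}}f(\boldsymbol{x})=|\mathcal{X}|^{-1}\sum_{n\in\mathcal{X}}f(x_1+\phi_1(n),\dots,x_r+\phi_r(n)),\qquad \boldsymbol{x}\in\mathbb{Z}^r.$$ For an integer $t\ge 0$, $\boldsymbol{a}\in\mathbb{Z}^r$ and an interval $I\subset\mathbb{Z}$, let $\mathcal{N}^{\gamma}_t(\mathcal{X},I,\boldsymbol{a})$ be the set of pairs $(\boldsymbol{m},\boldsymbol{n})\in(\mathcal{X}\cap I)^t\times(\mathcal{X}\cap I)^t$ with $\sum_{i=1}^t(\phi_j(n_i)-\phi_j(m_i))=a_j$ for all $1\le j\le r$, and let $$\mathcal{M}^{\gamma}_t(\mathcal{X},I)=\sup\{|\mathcal{N}^{\gamma}_t(\mathcal{X},I,\boldsymbol{a})|:\boldsymbol{a}\in\mathbb{Z}^r,\ a_j\ne0\text{ for every }1\le j\le r\}$$ (for $t=0$ the empty sums are $0$, so $\mathcal{M}^\gamma_0=0$). $\ell^{p,1}$ and $\ell^{p',\infty}$ are the usual Lorentz spaces on $\mathbb{Z}^r$ with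 counting measure. Up to a constant depending only on $p$, the operator norm $\|T\|_{\ell^{p,1}\to\ell^{p',\infty}}$ of a positive operator $T$ is the least $C$ with $\langle T\mathbf{1}_E,\mathbf{1}_F\rangle\le C|E|^{1/p}|F|^{1/p}$ for all finite nonempty $E,F\subset\mathbb{Z}^r$. *)

(* Defs.v *)
From HB Require Import structures.
From mathcomp Require Import all_boot all_order all_algebra.
From mathcomp Require Import finmap complex.
From mathcomp Require Import all_classical all_reals all_analysis.

Set Implicit Arguments.
Unset Strict Implicit.
Unset Printing Implicit Defensive.

Import Order.TTheory GRing.Theory Num.Theory.
Import numFieldNormedType.Exports.

Local Open Scope classical_set_scope.
Local Open Scope ring_scope.

(* The zero polynomial gets degree 0, so [0 < deg p] excludes it. *)
Definition deg (p : {poly int}) : nat := (size p).-1.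

Definition separated_system (r : nat) (gamma : 'I_r -> {poly int}) : Prop :=
  (forall j, (1 <= deg (gamma j))%N) /\
  (forall i j : 'I_r, (i < j)%N -> (deg (gamma i) < deg (gamma j))%N).

Definition single_linear (r : nat) (gamma : 'I_r -> {poly int}) : Prop :=
  r = 1%N /\ forall j, deg (gamma j) = 1%N.

Definition poly_average (R : realType) (r : nat) (gamma : 'I_r -> {poly int})
    (X : {fset nat}) (f : 'rV[int]_r -> R[i]) (x : 'rV[int]_r) : R[i] :=
  (#|` X|%:R)^-1 * \sum_(n <- X) f (x + \row_j (gamma j).[n%:Z]).

Definition cap_interval (X : {fset nat}) (I : interval int) : {fset nat} :=
  [fset n in X | n%:Z \in I]%fset.

(* The solution set N_t(X, I, a), as a set of pairs (m, n). *)
Definition solutions (r : nat) (gamma : 'I_r -> {poly int}) (t : nat)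
    (X : {fset nat}) (I : interval int) (a : 'rV[int]_r) :=
  [set mn : {ffun 'I_t -> cap_interval X I} * {ffun 'I_t -> cap_interval X I}
  | [forall j, \sum_(i < t)
       ((gamma j).[(val (mn.2 i))%:Z] - (gamma j).[(val (mn.1 i))%:Z]) == a 0 j]]%SET.

(* A supremum of natural numbers bounded by #|X| ^ (2 * t). *)
Definition max_solutions (R : realType) (r : nat) (gamma : 'I_r -> {poly int})
    (t : nat) (X : {fset nat}) (I : interval int) : R :=
  sup [set #|solutions gamma t X I a|%:R | a in
        [set a : 'rV[int]_r | forall j, a 0 j != 0]].

Section Lorentz.
Context {R : realType} {T : choiceType}.
Implicit Types (f : T -> R[i]) (p q : \bar R).
Local Open Scope ereal_scope.

Definition distribution_fun f (l : R) : \bar R :=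
  counting [set x | (l < Normc.normc (f x))%R].

Definition rearrangement f (t : R) : \bar R :=
  ereal_inf [set l%:E | l in [set l | (0 <= l)%R /\ distribution_fun f l <= t%:E]].

(* The (p, q) Lorentz quasinorm for counting measure on T; only 0 < p and
   0 < q are meaningful.  For p = +oo the exponent [fine p^-1] is 0, so that
   the (+oo, +oo) quasinorm is the supremum norm. *)
Definition lorentz_norm p q f : \bar R :=
  match q with
  | q'%:E =>
      (\int[lebesgue_measure]_(t in `]0%R, +oo[)
         (((t `^ fine (p^-1)%E)%:E * rearrangement f t) `^ q' * (t^-1)%:E)) `^ (q'^-1)%R
  | _ => ereal_sup [set (t `^ fine (p^-1)%E)%:E * rearrangement f t
                   | t in [set t : R | (0 < t)%R]]
  end.

Definition lorentz_opnorm p1 q1 p2 q2 (A : (T -> R[i]) -> (T -> R[i])) : \bar R :=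
  ereal_inf [set K%:E | K in [set K : R | (0 <= K)%R /\
    forall f, lorentz_norm p1 q1 f < +oo ->
      lorentz_norm p2 q2 (A f) <= K%:E * lorentz_norm p1 q1 f]].

End Lorentz.

(* Main.v *)
(* The bound reduces to a count of incidences J between finite sets E and F,
   i.e. of pairs (x, n) with x in F, n in X and x + gamma(n) in E.  Pruning the
   bipartite graph to vertices whose degree is comparable to the average
   degrees J/|F| and J/|E|, and walking 2s - 1 steps from a surviving vertex,
   gives at least about (J/|F|)^s (J/|E|)^(s-1) walks with at most |E| endpoints.
   The walks with given endpoints solve a system in 2s - 1 variables: fixing the
   last one leaves a system with s - 1 pairs of variables, whose right-hand side
   has a zero coordinate for boundedly many choices only.  Hence there are
   O(|X|^(s-1) + |X| M_(s-1)) of them, zero right-hand sides being absorbed by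
   the inequality |X| M_(t-1) <= M_t (repeat a variable on both sides).
   The passage from sets to functions is an Abel summation along the decreasing
   rearrangement. *)
Require Import Defs.
From HB Require Import structures.
From mathcomp Require Import all_boot all_order all_algebra.
From mathcomp Require Import finmap complex.
From mathcomp Require Import all_classical all_reals all_analysis.
From mathcomp Require Import measurable_realfun ring lra.

Set Implicit Arguments.
Unset Strict Implicit.
Unset Printing Implicit Defensive.

Import Order.TTheory GRing.Theory Num.Theory.
Import numFieldNormedType.Exports.

Local Open Scope ring_scope.

(** * Walks and incidences *)

Section Walks.
Context {R : realFieldType} {V : zmodType} {K : choiceType}.
Variables (X : {fset K}) (g : K -> V).
Implicit Types (E F : {fset V}) (x y v z : V) (t : nat).

Let N : R := #|` X|%:R.

(** The number of pairs $(m,n)\in X^t\times X^t$ with $\sum_i(g(n_i)-g(m_i))=v$. The recursion peels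
    off one pair at a time, for induction on [t]. *)
Fixpoint walks t v : R :=
  if t is t'.+1 then \sum_(m <- X) \sum_(n <- X) walks t' (v + g m - g n)
  else (v == 0)%:R.

Lemma walks_ge0 t v : 0 <= walks t v.
Proof. by elim: t v => [|t IH] v //=; do 2!apply: sumr_ge0 => ? _. Qed.

Lemma sum_fset_const (c : R) : \sum_(n <- X) c = N * c.
Proof.
by rewrite big_const_seq count_predT iter_addr_0 -mulr_natl.
Qed.

(** The terms with [m = n] alone give this. *)
Lemma walks_diag t v : N * walks t v <= walks t.+1 v.
Proof.
rewrite -sum_fset_const /= big_seq [leRHS]big_seq; apply: ler_sum => m mX.
rewrite (big_fsetD1 m) //= addrK lerDl.
by apply: sumr_ge0 => ? _; apply: walks_ge0.
Qed.

Lemma sum_exceptional (bad : pred V) (h : V -> R) (D A B : R) v :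
  (forall v, \sum_(n <- X) (bad (v - g n))%:R <= D) ->
  0 <= A -> 0 <= B ->
  (forall v, ~~ bad v -> h v <= A) -> (forall v, h v <= B) ->
  \sum_(n <- X) h (v - g n) <= N * A + D * B.
Proof.
move=> hD A0 B0 hA hB.
apply: (@le_trans _ _ (\sum_(n <- X) (A + (bad (v - g n))%:R * B))).
  apply: ler_sum => n _; case: (boolP (bad _)) => b.
    by rewrite mul1r (le_trans (hB _)) // lerDr.
  by rewrite mul0r addr0 hA.
rewrite big_split /= sum_fset_const lerD2l -mulr_suml.
by rewrite ler_wpM2r.
Qed.

(** Peel off a pair $(m,n)$. For each [m], at most [D] values of [n] lead to a bad vector, where the
    inductive bound is used; the others are good and fall under the hypothesis. Iterating costs the
    geometric sum in [D]. *)
Lemma walks_le (bad : pred V) (D : R) t : X != fset0 ->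
  (forall v, \sum_(n <- X) (bad (v - g n))%:R <= D) ->
  forall M, 0 <= M -> (forall v, ~~ bad v -> walks t v <= M) ->
  forall v, walks t v <= (\sum_(i < t.+1) D ^+ i) * (N ^+ t + N * M).
Proof.
move=> X0 hD.
have N0 : 0 < N by rewrite ltr0n cardfs_gt0.
have D0 : 0 <= D by apply: le_trans (hD 0); apply: sumr_ge0 => ? _.
(* The induction hypothesis is applied with M / N, thanks to [walks_diag]. *)
elim: t => [|t IH] M M0 hM v.
  rewrite big_ord1 expr0 mul1r (@le_trans _ _ 1) //=; first by case: (_ == _).
  by rewrite lerDl mulr_ge0 // ltW.
have hM' u : ~~ bad u -> walks t u <= M / N.
  by move=> bu; rewrite ler_pdivlMr // mulrC (le_trans (walks_diag t u)) ?hM.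
have MN0 : 0 <= M / N by rewrite divr_ge0 // ltW.
have {}IH := IH _ MN0 hM'.
set C := \sum_(i < t.+1) D ^+ i in IH.
have C0 : 0 <= C by apply: sumr_ge0 => i _; rewrite exprn_ge0.
rewrite mulrCA divff ?mulr1 ?gt_eqF // in IH.
have H0 : 0 <= C * (N ^+ t + M) by rewrite mulr_ge0 // addr_ge0 // exprn_ge0 // ltW.
have -> : \sum_(i < t.+2) D ^+ i = 1 + D * C.
  by rewrite big_ord_recl expr0 /C mulr_sumr; congr (_ + _);
     apply: eq_bigr => i _; rewrite -exprS.
apply: (@le_trans _ _ (\sum_(m <- X) (N * (M / N) + D * (C * (N ^+ t + M))))).
  by apply: ler_sum => m _; apply: (sum_exceptional (bad := bad)).
rewrite sum_fset_const [N * (M / N)]mulrC divfK ?gt_eqF //.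
have -> : N * (M + D * (C * (N ^+ t + M))) =
    N * M + D * C * (N ^+ t.+1 + N * M) by rewrite exprS; ring.
by rewrite mulrDl mul1r lerD2r lerDr exprn_ge0 // ltW.
Qed.

(** The outer sum adds one unpaired variable, for $2t+1$ in all. Splitting it into good and bad
    values extends the geometric sum by one term. *)
Lemma sum_walks_le (bad : pred V) (D : R) t M v : X != fset0 ->
  (forall v, \sum_(n <- X) (bad (v - g n))%:R <= D) ->
  0 <= M -> (forall v, ~~ bad v -> walks t v <= M) ->
  \sum_(n <- X) walks t (v - g n) <=
    (\sum_(i < t.+2) D ^+ i) * (N ^+ t + N * M).
Proof.
move=> X0 hD M0 hM.
have D0 : 0 <= D by apply: le_trans (hD 0); apply: sumr_ge0 => ? _.
have N0 : 0 <= N by [].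
have S0 : 0 <= \sum_(i < t.+1) D ^+ i.
  by apply: sumr_ge0 => i _; rewrite exprn_ge0.
have Q0 : 0 <= N ^+ t + N * M by rewrite addr_ge0 ?exprn_ge0 ?mulr_ge0.
apply: (le_trans (sum_exceptional _ hD M0 _ hM (walks_le X0 hD M0 hM))).
  by rewrite mulr_ge0.
rewrite [in leRHS]big_ord_recl expr0 mulrDl mul1r lerD ?lerDr ?exprn_ge0 //.
rewrite mulrA mulr_sumr.
by under eq_bigr do rewrite -exprS; rewrite lexx.
Qed.

(** For [g] the polynomial curve this is $|X|\langle A 1_E,1_F\rangle$. *)
Definition incidences E F : R := \sum_(x <- F) \sum_(n <- X) (x + g n \in E)%:R.

Lemma sum_eq_mem E z : \sum_(y <- E) (y == z)%:R = (z \in E)%:R :> R.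
Proof.
rewrite -natr_sum -big_mkcond sum1_count.
by rewrite (count_uniq_mem _ (fset_uniq E)).
Qed.

Lemma incidences_dual E F :
  incidences E F = \sum_(y <- E) \sum_(n <- X) (y - g n \in F)%:R.
Proof.
rewrite /incidences exchange_big [RHS]exchange_big; apply: eq_bigr => n _ /=.
under eq_bigr do rewrite -sum_eq_mem.
rewrite exchange_big /=; apply: eq_bigr => y _.
by rewrite -sum_eq_mem; apply: eq_bigr => x _; rewrite [in RHS]eq_sym subr_eq.
Qed.

(** Deleting from [F] a point of degree below [a] removes fewer than [a] incidences and lowers the
    other side by exactly [a]; likewise for [E] and [b]. The strict inequality thus survives every
    deletion, and it forbids an empty [F]. *)
Lemma prune (a b : R) E F : 0 <= a -> 0 <= b ->
  a * #|` F|%:R + b * #|` E|%:R < incidences E F ->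
  exists E' F', [/\ (E' `<=` E)%fset, F' != fset0,
    forall x, x \in F' -> a <= \sum_(n <- X) (x + g n \in E')%:R &
    forall y, y \in E' -> b <= \sum_(n <- X) (y - g n \in F')%:R].
Proof.
move=> a0 b0.
move: {2}(_ + _)%N (leqnn (#|` F| + #|` E|)) => k.
elim: k E F => [|k IH] E F.
  rewrite leqn0 addn_eq0 !cardfs_eq0 => /andP[/eqP -> /eqP ->].
  by rewrite !cardfs0 /incidences big_seq_fset0 !mulr0 addr0 ltxx.
move=> le_k lt_inc.
have [|/hasPn hF] := boolP (has (fun x => \sum_(n <- X) (x + g n \in E)%:R < a) F).
  move=> /hasP[x xF xa].
  apply: (IH E (F `\ x)%fset).
    by move: le_k; rewrite (cardfsD1 x F) xF addSn ltnS.
  move: lt_inc; rewrite (cardfsD1 x F) xF /incidences (big_fsetD1 x) //=.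
  by rewrite natrD mulrDr; lra.
have [|/hasPn hE] := boolP (has (fun y => \sum_(n <- X) (y - g n \in F)%:R < b) E).
  move=> /hasP[y yE yb].
  have [||E' [F' [sE' *]]] := IH (E `\ y)%fset F.
  - by move: le_k; rewrite (cardfsD1 y E) yE addnCA addSn ltnS.
  - move: lt_inc; rewrite (cardfsD1 y E) yE !incidences_dual (big_fsetD1 y) //=.
    by rewrite natrD mulrDr; lra.
  - by exists E', F'; split=> //; apply: fsubset_trans sE' (fsubD1set _ _).
exists E, F; split => //; last 2 first.
- by move=> x /hF; rewrite -leNgt.
- by move=> x /hE; rewrite -leNgt.
apply: contraTneq lt_inc => ->.
by rewrite /incidences big_seq_fset0 -leNgt addr_ge0 // mulr_ge0.
Qed.

(** Each round goes from a point of [E'] to [F'] in at least [b] ways, then back to [E'] in at least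
    [a] ways. *)
Lemma walks_ge (a b : R) E E' F' t y : 0 <= a -> 0 <= b ->
  (E' `<=` E)%fset ->
  (forall x, x \in F' -> a <= \sum_(n <- X) (x + g n \in E')%:R) ->
  (forall y, y \in E' -> b <= \sum_(n <- X) (y - g n \in F')%:R) ->
  y \in E' -> (b * a) ^+ t <= \sum_(z <- E) walks t (z - y).
Proof.
move=> a0 b0 sE hF hE; elim: t y => [|t IH] y yE /=.
  under eq_bigr do rewrite subr_eq0.
  by rewrite sum_eq_mem (fsubsetP sE).
rewrite exchange_big /= exprS -mulrA.
apply: (@le_trans _ _ (\sum_(m <- X) (y - g m \in F')%:R * (a * (b * a) ^+ t))).
  by rewrite -mulr_suml ler_wpM2r ?hE // mulr_ge0 // exprn_ge0 // mulr_ge0.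
apply: ler_sum => m _; rewrite exchange_big /=.
have S0 : forall n, 0 <= \sum_(z <- E) walks t (z - y + g m - g n).
  by move=> n; apply: sumr_ge0 => *; apply: walks_ge0.
case: (boolP (y - g m \in F')) => hm; last first.
  by rewrite mul0r; apply: sumr_ge0.
rewrite mul1r.
apply: (@le_trans _ _ (\sum_(n <- X) (y - g m + g n \in E')%:R * (b * a) ^+ t)).
  by rewrite -mulr_suml ler_wpM2r ?hF // exprn_ge0 // mulr_ge0.
apply: ler_sum => n _; case: (boolP (_ \in E')) => hn; last by rewrite mul0r.
rewrite mul1r (le_trans (IH _ hn)) //.
rewrite [leLHS](eq_bigr (fun z => walks t (z - y + g m - g n))) // => z _.
by rewrite !opprD opprK !addrA.
Qed.

Lemma incidences_expr_le (Q : R) E F t :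
  (forall v, \sum_(n <- X) walks t (v - g n) <= Q) ->
  incidences E F ^+ (2 * t).+1 <=
    4 ^+ (2 * t).+1 * (#|` E|%:R * #|` F|%:R) ^+ t.+1 * Q.
Proof.
move=> hQ.
have Q0 : 0 <= Q.
  by apply: le_trans (hQ 0); apply: sumr_ge0 => *; apply: walks_ge0.
set J := incidences E F; set e : R := #|` E|%:R; set f : R := #|` F|%:R.
have J0 : 0 <= J by do 2!apply: sumr_ge0 => ? _.
have R0 : 0 <= 4 ^+ (2 * t).+1 * (e * f) ^+ t.+1 * Q.
  by rewrite mulr_ge0 // mulr_ge0 // exprn_ge0 // mulr_ge0.
have [->|J1] := eqVneq J 0; first by rewrite expr0n.
have {}J1 : 0 < J by rewrite lt_neqAle eq_sym J1.
have f0 : 0 < f.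
  rewrite ltr0n cardfs_gt0; apply: contraTneq J1 => F0.
  by rewrite /J /incidences F0 big_seq_fset0 ltxx.
have e0 : 0 < e.
  rewrite ltr0n cardfs_gt0; apply: contraTneq J1 => E0.
  by rewrite /J incidences_dual E0 big_seq_fset0 ltxx.
(* With these thresholds [a * f + b * e = J / 2 < J], as pruning requires. *)
pose a := J / (4 * f); pose b := J / (4 * e).
have a0 : 0 <= a by rewrite divr_ge0 // mulr_ge0 // ltW.
have b0 : 0 <= b by rewrite divr_ge0 // mulr_ge0 // ltW.
have [|E' [F' [sE /fset0Pn[x xF] hF hE]]] := prune a0 b0 (E := E) (F := F).
  rewrite -/e -/f -/J /a /b.
  have -> : J / (4 * f) * f + J / (4 * e) * e = J / 2 by field; rewrite !gt_eqF.
  lra.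
(* One step from [x] into [E'], then [t] full rounds: these walks end in [E], and each endpoint is
   reached at most [Q] times. *)
have H : a * (b * a) ^+ t <= e * Q.
  apply: (@le_trans _ _ (\sum_(n <- X) (x + g n \in E')%:R * (b * a) ^+ t)).
    by rewrite -mulr_suml ler_wpM2r ?hF // exprn_ge0 // mulr_ge0.
  apply: (@le_trans _ _ (\sum_(n <- X) \sum_(z <- E) walks t (z - x - g n))).
    apply: ler_sum => n _; case: (boolP (_ \in E')) => hn; last first.
      by rewrite mul0r; apply: sumr_ge0 => *; apply: walks_ge0.
    rewrite mul1r (le_trans (walks_ge t a0 b0 sE hF hE hn)) //.
    rewrite [leLHS](eq_bigr (fun z => walks t (z - x - g n))) // => z _.
    by rewrite opprD addrA.
  rewrite exchange_big /=.
  apply: (@le_trans _ _ (\sum_(z <- E) Q)); first by apply: ler_sum.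
  by rewrite big_const_seq count_predT iter_addr_0 -mulr_natl.
(* The thresholds give $J=4fa$ once and $J^2=16fe\,ba$ for each of the [t] rounds. *)
have -> : J ^+ (2 * t).+1 =
    4 ^+ (2 * t).+1 * (f ^+ t.+1 * e ^+ t) * (a * (b * a) ^+ t).
  have aE : J = 4 * f * a by rewrite /a mulrC divfK // gt_eqF // mulr_gt0.
  have abE : J ^+ 2 = 4 ^+ 2 * (f * e) * (b * a).
    by rewrite /a /b; field; rewrite !gt_eqF.
  rewrite !exprS !exprM abE {1}aE !exprMn.
  ring.
have -> : 4 ^+ (2 * t).+1 * (e * f) ^+ t.+1 * Q =
    4 ^+ (2 * t).+1 * (f ^+ t.+1 * e ^+ t) * (e * Q).
  by rewrite (exprMn _ e) (exprS e); ring.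
by rewrite ler_wpM2l // !mulr_ge0 // exprn_ge0 // ltW.
Qed.
End Walks.

(** * The polynomial curve *)

Section Solutions.
Context {R : realFieldType}.

(** Splits a tuple into head and tail, to match the recursion of [walks]. *)
Lemma sum_ffunS (T : finType) (t : nat) (F : {ffun 'I_t.+1 -> T} -> R) :
  \sum_m F m =
  \sum_(x : T) \sum_(m : {ffun 'I_t -> T})
     F [ffun i => if unlift ord0 i is Some j then m j else x].
Proof.
rewrite pair_big /=.
rewrite (reindex (fun p : T * {ffun 'I_t -> T} =>
  [ffun i => if unlift ord0 i is Some j then p.2 j else p.1])) //=.
exists (fun m => (m ord0, [ffun j => m (lift ord0 j)])) => [[x m] _|m _] /=.
  rewrite ffunE unlift_none; congr (_, _); apply/ffunP => j.
  by rewrite !ffunE liftK.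
by apply/ffunP => i; rewrite ffunE; case: unliftP => [j|] -> //; rewrite ffunE.
Qed.

Lemma sum_walks (V : zmodType) (K : choiceType) (X : {fset K}) (g : K -> V) t a :
  \sum_(m : {ffun 'I_t -> X}) \sum_(n : {ffun 'I_t -> X})
    (\sum_i (g (val (n i)) - g (val (m i))) == a)%:R = walks X g t a :> R.
Proof.
elim: t a => [|t IH] a /=.
  under eq_bigr do under eq_bigr do rewrite big_ord0.
  by rewrite !sumr_const card_ffun card_ord expn0 !mulr1n eq_sym.
rewrite sum_ffunS [RHS]big_seq_fsetE /=; apply: eq_bigr => x _.
under eq_bigr do rewrite sum_ffunS.
rewrite exchange_big [RHS]big_seq_fsetE /=; apply: eq_bigr => y _.
rewrite -IH; apply: eq_bigr => m _; apply: eq_bigr => n _.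
rewrite big_ord_recl !ffunE unlift_none.
under eq_bigr do rewrite !ffunE liftK.
congr (nat_of_bool _)%:R; rewrite -subr_eq0 -[RHS]subr_eq0; congr (_ == _).
by rewrite [_ + \sum_ _ _]addrC opprB [a + _]addrC opprD -!addrA.
Qed.
End Solutions.

(** * Solution counts and vectors with a zero coordinate *)

Section Exceptional.
Context {R : realFieldType} {r : nat}.
Variable gamma : 'I_r -> {poly int}.

Definition curve (n : nat) : 'rV[int]_r := \row_j (gamma j).[n%:Z].

(** Since [X] lies in [I], intersecting changes nothing, and the $r$ scalar equations form one
    vector equation along the curve. *)
Lemma card_solutions t (X : {fset nat}) (I : interval int) (a : 'rV[int]_r) :
  (forall n, n \in X -> n%:Z \in I) ->
  #|solutions gamma t X I a|%:R = walks X curve t a :> R.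
Proof.
move=> XI.
have capX : cap_interval X I = X.
  apply/fsetP => n; rewrite !inE; apply/andP/idP => [[]//|nX].
  by split => //; apply: XI.
rewrite -[X in walks X]capX -sum_walks pair_big /= -sum1_card natr_sum big_mkcond /=.
apply: eq_bigr => -[m n] _; rewrite inE /=.
have -> : [forall j, \sum_i ((gamma j).[(val (n i))%:Z] -
      (gamma j).[(val (m i))%:Z]) == a 0 j] =
    (\sum_i (curve (val (n i)) - curve (val (m i))) == a).
  apply/forallP/eqP => [H|<- j].
    apply/rowP => j; rewrite -(eqP (H j)) summxE.
    by apply: eq_bigr => i _; rewrite !mxE.
  by rewrite summxE; apply/eqP/eq_bigr => i _; rewrite !mxE.
by case: ifP.
Qed.

(** The bad vectors: those left out of the supremum in [max_solutions]. *)
Definition has_zero_coord (v : 'rV[int]_r) : bool := [exists j, v 0 j == 0].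

Lemma sum_root_le (X : {fset nat}) (q : {poly int}) (c : int) : (0 < deg q)%N ->
  \sum_(n <- X) (q.[n%:Z] == c)%:R <= (deg q)%:R :> R.
Proof.
rewrite /deg => q0; rewrite -natr_sum -big_mkcond sum1_count ler_nat -size_filter.
(* Subtracting a constant keeps the size of a nonconstant polynomial, so $q-c$ is nonzero and has at
   most [deg q] roots. *)
have szc : (size (- c%:P) < size q)%N.
  by rewrite size_polyN (leq_ltn_trans (size_polyC_leq1 _)) // -ltn_predRL.
rewrite -(size_map Posz) -ltnS prednK; last by case: (size q) q0.
rewrite -(size_polyDl szc) max_poly_roots //.
- by rewrite -size_poly_gt0 size_polyDl // (leq_ltn_trans _ szc).
- apply/allP => _ /mapP[n + ->]; rewrite mem_filter => /andP[/eqP qn _].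
  by rewrite rootE hornerD hornerN hornerC qn subrr.
- by rewrite map_inj_uniq ?filter_uniq ?fset_uniq // => ? ? [].
Qed.

(** Union bound over the coordinates, each of which vanishes for at most [deg (gamma j)] values of
    [n]. *)
Lemma sum_zero_coord_le (X : {fset nat}) v : (forall j, 1 <= deg (gamma j))%N ->
  \sum_(n <- X) (has_zero_coord (v - curve n))%:R <=
    \sum_j (deg (gamma j))%:R :> R.
Proof.
move=> hd.
apply: (@le_trans _ _ (\sum_(n <- X) \sum_j ((gamma j).[n%:Z] == v 0 j)%:R)).
  apply: ler_sum => n _.
  have [/existsP[j]|_] := boolP (has_zero_coord _); last by apply: sumr_ge0.
  rewrite !mxE subr_eq0 eq_sym (bigD1 j) //= => -> /=.
  by rewrite lerDl; apply: sumr_ge0.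
by rewrite exchange_big; apply: ler_sum => j _; apply: sum_root_le.
Qed.
End Exceptional.

Section MaxSolutions.
Context {R : realType} {r : nat}.
Variable gamma : 'I_r -> {poly int}.
Variables (t : nat) (X : {fset nat}) (I : interval int).

Lemma solutions_le_max (a : 'rV[int]_r) : (forall j, a 0 j != 0) ->
  #|solutions gamma t X I a|%:R <= max_solutions R gamma t X I.
Proof.
move=> ha; apply: ub_le_sup; last by exists a.
(* The number of all pairs of tuples bounds the counts uniformly in [a]. *)
exists #|[set: {ffun 'I_t -> cap_interval X I} *
             {ffun 'I_t -> cap_interval X I}]%SET|%:R.
by move=> _ [b _ <-]; rewrite ler_nat subset_leq_card // subsetT.
Qed.

Lemma max_solutions_ge0 : 0 <= max_solutions R gamma t X I.
Proof.
apply: le_trans (solutions_le_max (a := const_mx 1) _) => //.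
by move=> j; rewrite mxE.
Qed.
End MaxSolutions.

(** The $(2t+1)$-th root of [incidences_expr_le], where [t] stands for $s-1$. The constant depends
    only on [t] and the degrees. *)
Lemma restricted_bound (R : realType) (r : nat) (gamma : 'I_r -> {poly int})
    (t : nat) : (forall j, 1 <= deg (gamma j))%N ->
  exists2 C : R, 0 < C & forall (X : {fset nat}) (I : interval int)
    (E F : {fset 'rV[int]_r}),
    X != fset0 -> (forall n, n \in X -> n%:Z \in I) ->
    incidences X (curve gamma) E F <=
     C * (#|` X|%:R ^+ t + #|` X|%:R * max_solutions R gamma t X I)
         `^ ((2 * t).+1%:R)^-1 *
     (#|` E|%:R * #|` F|%:R) `^ (t.+1%:R / (2 * t).+1%:R).
Proof.
move=> hd; pose D : R := \sum_j (deg (gamma j))%:R.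
have D0 : 0 <= D by apply: sumr_ge0.
pose c := \sum_(i < t.+2) D ^+ i.
have c1 : 0 < c.
  rewrite /c big_ord_recl expr0 ltr_pwDl //.
  by apply: sumr_ge0 => i _; rewrite exprn_ge0.
pose k : R := ((2 * t).+1%:R)^-1.
exists (4 * c `^ k); first by rewrite mulr_gt0 // powR_gt0.
move=> X I E F X0 XI; rewrite -/k.
set W := _ ^+ t + _.
have W0 : 0 <= W by rewrite addr_ge0 ?exprn_ge0 // mulr_ge0 // max_solutions_ge0.
have hQ v : \sum_(n <- X) walks X (curve gamma) t (v - curve gamma n) <= c * W.
  apply: (sum_walks_le (bad := @has_zero_coord r)) => //.
  - by move=> ?; apply: sum_zero_coord_le.
  - exact: max_solutions_ge0.
  - move=> u /existsPn hu; rewrite -(card_solutions gamma t u XI).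
    exact: solutions_le_max.
have := incidences_expr_le E F hQ.
set J := incidences _ _ _ _; set e := #|` E|%:R * _ => H.
have J0 : 0 <= J by do 2!apply: sumr_ge0 => ? _.
have e0 : 0 <= e by rewrite mulr_ge0.
have rootK (a : R) : 0 <= a -> (a ^+ (2 * t).+1) `^ k = a.
  by move=> a0; rewrite -powR_mulrn // -powRrM divff ?pnatr_eq0 // powRr1.
rewrite -[leLHS]rootK //.
apply: (@le_trans _ _ ((4 ^+ (2 * t).+1 * e ^+ t.+1 * (c * W)) `^ k)).
  rewrite ge0_ler_powR ?nnegrE ?invr_ge0 ?exprn_ge0 //.
  by rewrite !mulr_ge0 ?exprn_ge0 // ltW.
have c0 := ltW c1.
rewrite powRM ?mulr_ge0 ?exprn_ge0 // powRM ?exprn_ge0 // powRM // rootK //.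
rewrite -[e ^+ _]powR_mulrn // -powRrM.
by rewrite le_eqVlt; apply/orP; left; apply/eqP; ring.
Qed.

(** * Lorentz norms *)

Lemma normc_ge0 (R : rcfType) (z : R[i]) : 0 <= Normc.normc z.
Proof. by case: z => a b; apply: sqrtr_ge0. Qed.

Section Counting.
Context {R : realType} {T : choiceType}.
Local Open Scope ereal_scope.

Lemma counting_ge (P : {fset T}) (S : set T) : (forall x, x \in P -> S x) ->
  (#|` P|%:R)%:E <= counting S :> \bar R.
Proof.
rewrite /counting => PS; case: ifPn => [/asboolP finS|_]; last exact: leey.
rewrite lee_fin ler_nat fsubset_leq_card //; apply/fsubsetP => x xP.
by rewrite in_fset_set // inE; apply: PS.
Qed.

Lemma counting_le (S : set T) (t : R) :
  (forall P : {fset T}, (forall x, x \in P -> S x) -> (#|` P|%:R <= t)%R) ->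
  counting S <= t%:E.
Proof.
rewrite /counting => St; case: ifPn => [/asboolP finS|/asboolP infS].
  by rewrite lee_fin St // => x; rewrite in_fset_set // inE.
(* An infinite set would contain a finite subset with more than [t] elements. *)
have [B BS] := infinite_set_fset (Num.truncn t).+1 infS.
rewrite -(ler_nat R) => /le_trans/(_ (St B _))-/(_ BS).
by rewrite leNgt truncnS_gt.
Qed.

(** A level [l < c] is exceeded on all of [P], hence at more than [t] points, so it is not
    admissible in the infimum. *)
Lemma rearrangement_ge (f : T -> R[i]) (P : {fset T}) (c t : R) :
  (forall x, x \in P -> c <= Normc.normc (f x))%R -> (t < #|` P|%:R)%R ->
  c%:E <= rearrangement f t.
Proof.
move=> cP tP; apply: le_ereal_inf_tmp => _ [l [_ hl] <-].
rewrite lee_fin leNgt; apply/negP => lc.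
have /le_trans/(_ hl) : (#|` P|%:R)%:E <= distribution_fun f l.
  by apply: counting_ge => x /cP; apply: lt_le_trans.
by rewrite lee_fin leNgt tP.
Qed.

Lemma rearrangement_ge0 (f : T -> R[i]) t : 0 <= rearrangement f t.
Proof. by apply: le_ereal_inf_tmp => _ [l [l0 _] <-]; rewrite lee_fin. Qed.
End Counting.

(* Spares the measurability of the rearrangement. *)
Lemma ge0_le_integral_nonmeasurable d (T : measurableType d) (R : realType)
    (mu : {measure set T -> \bar R}) (D : set T) (f1 f2 : T -> \bar R) :
  (forall x, D x -> 0 <= f1 x)%E -> (forall x, D x -> f1 x <= f2 x)%E ->
  (\int[mu]_(x in D) f1 x <= \int[mu]_(x in D) f2 x)%E.
Proof.
move=> f10 f12.
have f20 x : D x -> (0 <= f2 x)%E by move=> Dx; rewrite (le_trans (f10 x Dx)) ?f12.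
rewrite !ge0_integralE //; apply: le_ereal_sup => _ [h hf <-].
exists h => // x; apply: le_trans (hf x) _; rewrite /patch.
by case: ifPn => // /set_mem; apply: f12.
Qed.

(** Abel summation against nonnegative decreasing weights. *)
Lemma sum_antitone_le0 (R : realDomainType) (w u : nat -> R) (k : nat) :
  (forall i, (i < k)%N -> 0 <= w i) ->
  (forall i, (i.+1 < k)%N -> w i.+1 <= w i) ->
  (forall i, (i <= k)%N -> \sum_(j < i) u j <= 0) ->
  \sum_(i < k) w i * u i <= 0.
Proof.
case: k => [|k] w0 wd hu; first by rewrite big_ord0.
(* The induction needs this stronger form, with the last weight kept as a factor of the whole
   partial sum. *)
suff: \sum_(i < k.+1) w i * u i <= w k * \sum_(i < k.+1) u i.
  by move=> /le_trans -> //; rewrite mulr_ge0_le0 ?w0 ?hu.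
elim: k w0 wd hu => [|k IH] w0 wd hu; first by rewrite !big_ord1.
rewrite big_ord_recr [in leRHS]big_ord_recr /= mulrDr lerD2r.
apply: (le_trans (IH _ _ _)) => [i ik|i ik|i ik|].
- by rewrite w0 // ltnW.
- by rewrite wd // ltnW.
- by rewrite hu // ltnW.
- by rewrite ler_wnM2r ?hu ?wd.
Qed.

(** * Lower bounds for the $(1/\theta,1)$ Lorentz norm *)

Section LorentzLower.
Context {R : realType} {T : choiceType}.
Variables (theta : R) (f : T -> R[i]).
Hypotheses (th0 : 0 < theta) (th1 : theta <= 1).
Local Notation g := (fun x => Normc.normc (f x)).

Lemma antitone_powR (i j : nat) : (i <= j)%N ->
  j.+1%:R `^ (theta - 1) <= i.+1%:R `^ (theta - 1) :> R.
Proof.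
move=> ij; rewrite -[theta - 1]opprB !powRN lef_pV2 ?posrE ?powR_gt0 //.
by rewrite ge0_ler_powR ?nnegrE ?subr_ge0 // ler_nat.
Qed.

(** The norm is $\int_0^\infty t^{\theta-1}f^*(t)\,dt$. For $i<t<i+1$, $f^*(t)$ is at least the
    value at entry [i] of [s], which $i+1$ points reach, and $t^{\theta-1}\ge(i+1)^{\theta-1}$. *)
Lemma lorentz_ge_sum (x0 : T) (s : seq T) :
  uniq s -> sorted (fun x y => g y <= g x) s ->
  ((\sum_(i < size s) g (nth x0 s i) * i.+1%:R `^ (theta - 1))%:E <=
    lorentz_norm (theta^-1)%:E 1 f)%E.
Proof.
move=> us ss; set k := size s.
pose c (i : 'I_k) := g (nth x0 s i) * i.+1%:R `^ (theta - 1).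
have g0 x : 0 <= g x := normc_ge0 (f x).
have c0 i : 0 <= c i by rewrite mulr_ge0 // powR_ge0.
rewrite /lorentz_norm invr1 poweRe1; last first.
  apply: integral_ge0 => t; rewrite /= in_itv /= andbT => t0.
  by rewrite mule_ge0 ?poweR_ge0 // lee_fin invr_ge0 ltW.
rewrite inver invr_eq0 (gt_eqF th0) invrK /=.
pose J (i : 'I_k) : set R := `]i%:R, i.+1%:R[%classic.
apply: (@le_trans _ _
  (\int[lebesgue_measure]_(t in `]0%R, +oo[) (\sum_i (c i)%:E * (\1_(J i) t)%:E)))%E.
  have mJ i : measurable_fun (`]0%R, +oo[%classic : set (measurableTypeR R))
      (fun t => (\1_(J i) t)%:E : \bar R).
    by apply/measurable_EFinP; apply: measurable_indic; apply: measurable_itv.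
  rewrite ge0_integral_sum // => [|i|i t _]; last 2 first.
  - exact: measurable_funeM.
  - by rewrite mule_ge0 ?lee_fin //; apply: c0.
  rewrite -sumEFin; apply: lee_sum => i _.
  have ci0 : (0 <= (c i)%:E)%E by rewrite lee_fin; apply: c0.
  rewrite ge0_integralZl //.
  have mJi : measurable (J i : set (measurableTypeR R)) by apply: measurable_itv.
  rewrite integral_indic //= setIidl; last first.
    by move=> t; rewrite /J /= !in_itv /= andbT => /andP[it _]; apply: le_lt_trans it.
  rewrite lebesgue_measure_itv /= lte_fin ltr_nat ltnSn -EFinB -natrB //.
  by rewrite subSnn mule1.
apply: ge0_le_integral_nonmeasurable => t; rewrite /= in_itv /= andbT => t0.
  by apply: sume_ge0 => i _; rewrite mule_ge0 ?lee_fin ?c0 ?ler0n //.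
rewrite poweRe1; last by rewrite mule_ge0 ?rearrangement_ge0 // lee_fin powR_ge0.
have [[i /andP[it ti]]|none] := pselect (exists i : 'I_k, i%:R < t < i.+1%:R).
  rewrite (bigD1 i) //= big1 ?adde0 => [|j ji]; last first.
    rewrite indicE memNset ?mule0 // /J /= in_itv /= => /andP[jt tj].
    have := lt_trans it tj; have := lt_trans jt ti; rewrite !ltr_nat !ltnS => h1 h2.
    by move: ji; rewrite -val_eqE eqn_leq h1 h2.
  rewrite indicE mem_set ?mule1; last by rewrite /J /= in_itv /= it.
  have gi : ((g (nth x0 s i))%:E <= rearrangement f t)%E.
    apply: (@rearrangement_ge _ _ _ [fset x in take i.+1 s]%fset).
      move=> x; rewrite !inE /= => /(nthP x0)[j].
      rewrite size_takel ?ltn_ord // => ji <-; rewrite nth_take //.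
      have tr : transitive (fun x y => g y <= g x).
        by move=> a b d ba db; apply: le_trans db ba.
      apply: (sorted_leq_nth tr) => //; rewrite inE ?ltn_ord //.
      exact: leq_trans ji (ltn_ord i).
    by rewrite card_fseq undup_id ?take_uniq // size_takel ?ltn_ord.
  rewrite muleAC -EFinM; apply: (@le_trans _ _
    ((t `^ theta * t^-1)%:E * (g (nth x0 s i))%:E)%E).
    rewrite -EFinM lee_fin /c mulrC ler_wpM2r //.
    rewrite -powR_inv1 ?(ltW t0) // -powRD; last by rewrite (gt_eqF t0) implybT.
    rewrite -[theta - 1]opprB !powRN lef_pV2 ?posrE ?powR_gt0 //.
    by rewrite ge0_ler_powR ?nnegrE ?subr_ge0 // ltW.
  by rewrite lee_wpmul2l // lee_fin mulr_ge0 ?powR_ge0 // invr_ge0 ltW.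
(* Off the open unit intervals the minorant is zero. *)
rewrite big1 => [|i _]; last first.
  by rewrite indicE memNset ?mule0 // /J /= in_itv /= => Jt; apply: none; exists i.
by rewrite !mule_ge0 ?rearrangement_ge0 ?lee_fin ?powR_ge0 // invr_ge0 ltW.
Qed.

(** Sort [P] by decreasing modulus of [f]. The hypothesis on initial segments and
    $n^\theta\le\sum_{j\le n}j^{\theta-1}$ make the partial sums of $c-Bj^{\theta-1}$ nonpositive;
    Abel summation and [lorentz_ge_sum] conclude. *)
Lemma lorentz_pairing (c : T -> R) (P : {fset T}) (B : R) : 0 <= B ->
  (forall E : {fset T}, (E `<=` P)%fset ->
     \sum_(y <- E) c y <= B * #|` E|%:R `^ theta) ->
  ((\sum_(y <- P) c y * g y)%:E <= B%:E * lorentz_norm (theta^-1)%:E 1 f)%E.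
Proof.
move=> B0 hc.
have g0 x : 0 <= g x := normc_ge0 (f x).
have [->|/fset0Pn[x0 _]] := eqVneq P fset0.
  by rewrite big_seq_fset0 mule_ge0 ?lee_fin // /lorentz_norm poweR_ge0.
pose leg x y := g y <= g x.
pose s := sort leg P.
have us : uniq s by rewrite sort_uniq fset_uniq.
have ss : sorted leg s by apply: sort_sorted => x y; apply: le_total.
apply: le_trans (lee_wpmul2l _ (lorentz_ge_sum x0 us ss)); last by rewrite lee_fin.
rewrite -EFinM lee_fin -subr_le0.
rewrite (perm_big s) /=; last by rewrite perm_sym perm_sort.
rewrite (big_nth x0) big_mkord mulr_sumr -sumrB.
rewrite (eq_bigr (fun i : 'I__ => g (nth x0 s i) *
   (c (nth x0 s i) - B * i.+1%:R `^ (theta - 1)))); last first.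
  by move=> i _; ring.
apply: (sum_antitone_le0 (w := fun i => g (nth x0 s i))
  (u := fun i => c (nth x0 s i) - B * i.+1%:R `^ (theta - 1))) => [i _|i ik|i ik].
- exact: g0.
- exact: (sortedP x0 ss).
rewrite sumrB -mulr_sumr subr_le0.
have {1}-> : \sum_(j < i) c (nth x0 s j) = \sum_(y <- [fset x in take i s]%fset) c y.
  rewrite (perm_big (take i s)); last first.
    apply: uniq_perm; rewrite ?fset_uniq ?take_uniq // => y.
    by rewrite in_fset.
  rewrite (big_nth x0) big_mkord size_takel //.
  by apply: eq_bigr => j _; rewrite nth_take.
apply: le_trans (hc _ _) _.
  apply/fsubsetP => y; rewrite in_fset /= => /mem_take.
  by rewrite mem_sort.
rewrite card_fseq undup_id ?take_uniq // size_takel // ler_wpM2l //.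
(* The empty segment uses [th0], since [powR] gives zero to the power zero the value 1. *)
case: i ik => [|i] ik.
  by rewrite big_ord0 powR0 // gt_eqF.
(* $(i+1)^\theta$ is $i+1$ copies of the smallest term of the sum. *)
apply: (@le_trans _ _ (\sum_(j < i.+1) i.+1%:R `^ (theta - 1))).
  rewrite sumr_const card_ord -(mulr_natl (_ `^ _)) -[X in X * _]powRr1 // -powRD.
    by rewrite addrC subrK.
  by rewrite pnatr_eq0 implybT.
by apply: ler_sum => j _; apply: antitone_powR; rewrite -ltnS.
Qed.
End LorentzLower.

(** * From incidence bounds to the weak-type estimate *)

Section WeakType.
Context {R : realType} {r : nat}.
Variables (gamma : 'I_r -> {poly int}) (X : {fset nat}).

Lemma normc_sum_le (I : Type) (s : seq I) (F : I -> R[i]) :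
  Normc.normc (\sum_(i <- s) F i) <= \sum_(i <- s) Normc.normc (F i).
Proof.
elim: s => [|i s IH]; first by rewrite !big_nil Normc.normc0.
by rewrite !big_cons (le_trans (le_normcD _ _)) // lerD2l.
Qed.

Lemma normc_nat n : Normc.normc (n%:R : R[i]) = n%:R.
Proof. by rewrite (normcMn 1) Normc.normc1. Qed.

Lemma poly_average_le (f : 'rV[int]_r -> R[i]) x :
  Normc.normc (poly_average gamma X f x) <=
  (#|` X|%:R)^-1 * \sum_(n <- X) Normc.normc (f (x + curve gamma n)).
Proof.
by rewrite Normc.normcM Normc.normcV normc_nat ler_wpM2l ?invr_ge0 // normc_sum_le.
Qed.

(** The substitution $y=x+c(n)$ passes to the adjoint of the averaging operator, applied to the
    indicator of [F]. *)
Lemma sum_translates (V : zmodType) (c : nat -> V) (F P : {fset V}) (h : V -> R) :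
  (forall x n, x \in F -> n \in X -> x + c n \in P) ->
  \sum_(x <- F) \sum_(n <- X) h (x + c n) =
  \sum_(y <- P) (\sum_(n <- X) (y - c n \in F)%:R) * h y.
Proof.
move=> FP; under [RHS]eq_bigr do rewrite mulr_suml.
rewrite exchange_big [RHS]exchange_big big_seq [RHS]big_seq.
apply: eq_bigr => n nX /=.
transitivity (\sum_(x <- F) \sum_(y <- P) (x == y - c n)%:R * h y); last first.
  by rewrite exchange_big; apply: eq_bigr => y _; rewrite -mulr_suml sum_eq_mem.
rewrite big_seq [RHS]big_seq; apply: eq_bigr => x xF.
rewrite (big_fsetD1 (x + c n)) ?FP //= addrK eqxx mul1r big_seq big1 ?addr0 //.
by move=> y; rewrite !inE [x == _]eq_sym subr_eq => /andP[/negPf -> _]; rewrite mul0r.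
Qed.

(** Suppose the average exceeds $bt^{\theta-1}$ in modulus on a finite set of $m>t$ points. Summing
    there gives more than $mbt^{\theta-1}$, while duality and [lorentz_pairing] give at most
    $bm^\theta$; this is impossible as $\theta\le1$. *)
Lemma lorentz_weak_bound (B theta : R) (f : 'rV[int]_r -> R[i]) (t : R) :
  0 < theta -> theta <= 1 -> 0 <= B -> 0 < t ->
  (forall E F : {fset 'rV[int]_r}, incidences X (curve gamma) E F <=
     B * (#|` E|%:R * #|` F|%:R) `^ theta) ->
  (lorentz_norm (theta^-1)%:E 1 f < +oo ->
  (t `^ (1 - theta))%:E * rearrangement (poly_average gamma X f) t <=
  ((#|` X|%:R)^-1 * B)%:E * lorentz_norm (theta^-1)%:E 1 f)%E.
Proof.
move=> th0 th1 B0 t0 hB.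
have := lorentz_pairing f th0 th1.
have : (0 <= lorentz_norm (theta^-1)%:E 1 f)%E by rewrite /lorentz_norm poweR_ge0.
case: (lorentz_norm _ _ _) => // l; rewrite lee_fin => l0 pairing _.
set N : R := #|` X|%:R.
pose b := N^-1 * B * l.
have b0 : 0 <= b by rewrite !mulr_ge0 ?invr_ge0.
suff H : (rearrangement (poly_average gamma X f) t <= (b * t `^ (theta - 1))%:E)%E.
  apply: le_trans (lee_wpmul2l _ H) _; first by rewrite lee_fin powR_ge0.
  rewrite -!EFinM lee_fin mulrCA -powRD; last by rewrite (gt_eqF t0) implybT.
  by rewrite addrC subrKA subrr powRr0 mulr1.
apply: ereal_inf_lbound; exists (b * t `^ (theta - 1)) => //=; split.
  by rewrite mulr_ge0 ?powR_ge0.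
apply: counting_le => F /= hF; rewrite leNgt; apply/negP => tF.
set m : R := #|` F|%:R in tF.
have m0 : 0 < m by apply: lt_trans tF.
pose P := [fset (x + curve gamma n)%R | x in F, n in X]%fset.
have FP x n : x \in F -> n \in X -> x + curve gamma n \in P.
  by move=> xF nX; apply/imfset2P; exists x => //; exists n.
have le1 : \sum_(x <- F) Normc.normc (poly_average gamma X f x) <= b * m `^ theta.
  apply: (@le_trans _ _ (N^-1 * \sum_(x <- F) \sum_(n <- X)
      Normc.normc (f (x + curve gamma n)))).
    by rewrite mulr_sumr; apply: ler_sum => x _; apply: poly_average_le.
  rewrite /b -!mulrA ler_wpM2l ?invr_ge0 //.
  rewrite (sum_translates (fun y => Normc.normc (f y)) FP) [l * _]mulrC mulrA.
  (* The weight at [y] counts the [n] with [y - curve gamma n] in [F]. Its sums over [E] are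
     incidences, so the constant is $Bm^\theta$. *)
  rewrite -lee_fin EFinM; apply: pairing => [|E _].
    by rewrite mulr_ge0 ?powR_ge0.
  rewrite -incidences_dual (le_trans (hB _ _)) // -mulrA ler_wpM2l //.
  by rewrite powRM // mulrC.
have : m * (b * t `^ (theta - 1)) < b * m `^ theta.
  apply: lt_le_trans le1.
  rewrite -sum_fset_const big_seq [ltRHS]big_seq; apply: ltr_sum => //.
  have /fset0Pn[x xF] : F != fset0 by rewrite -cardfs_gt0 -(ltr_nat R).
  by apply/hasP; exists x.
apply/negP; rewrite -leNgt mulrCA ler_wpM2l //.
have -> : m `^ theta = m * m `^ (theta - 1).
  rewrite -{2}[m]powRr1 ?(ltW m0) // -powRD; last by rewrite (gt_eqF m0) implybT.
  by rewrite addrC subrK.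
rewrite ler_wpM2l ?(ltW m0) // -[theta - 1]opprB !powRN.
rewrite lef_pV2 ?posrE ?powR_gt0 //.
by rewrite ge0_ler_powR ?nnegrE ?subr_ge0 // ltW.
Qed.
End WeakType.

(** Read off from $1/p+1/p'=1$. This includes $p=1$, the case $s=1$, where the exponent is 0. *)
Lemma fine_inv_conjugate (R : realType) (p : R) : 0 < p ->
  fine (hoelder_conjugate p%:E)^-1%E = 1 - p^-1.
Proof.
move=> p0; have := @hoelder_conjugate_eq1 R p%:E (ltNyr _).
rewrite eqe (gt_eqF p0) inver (gt_eqF p0) => /(_ isT).
by case: (_^-1)%E => // q [<-] /=; rewrite addrC addrK.
Qed.

Theorem theorem1p3 (R : realType) (r : nat) (gamma : 'I_r -> {poly int})
    (hr : (1 <= r)%N) (hgamma : separated_system gamma)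
    (hlin : ~ single_linear gamma)
    (s : nat) (hs : (1 <= s)%N) (p : R) (hp : p = 2 - s%:R^-1) :
  exists2 C : R, 0 < C &
    forall (X : {fset nat}) (I : interval int),
      X != fset0 ->
      (forall n, n \in X -> (1 <= n)%N) ->
      (forall n, n \in X -> n%:Z \in I) ->
      (lorentz_opnorm p%:E 1%E (hoelder_conjugate p%:E) +oo%E
         (@poly_average R r gamma X)
       <= (C * (#|` X|%:R)^-1 *
           (#|` X|%:R ^+ (s.-1) + #|` X|%:R * max_solutions R gamma s.-1 X I)
             `^ (2 * s%:R - 1)^-1)%:E)%E.
Proof.
have [C C0 bound] := restricted_bound R s.-1 hgamma.1.
exists C => // X I X0 _ XI.
case: s hs hp bound => // t _ hp bound; rewrite /= in bound *.
(* With $s=t+1$ this is $s/(2s-1)=1/p$. *)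
pose theta : R := t.+1%:R / (2 * t).+1%:R.
have th0 : 0 < theta by rewrite divr_gt0 // ltr0n.
have th1 : theta <= 1.
  by rewrite ler_pdivrMr ?ltr0n // mul1r ler_nat ltnS mul2n -addnn leq_addr.
have kE : 2 * t.+1%:R - 1 = (2 * t).+1%:R :> R.
  by rewrite -natr1 -[(2 * t).+1%:R]natr1 natrM; ring.
have pE : p = theta^-1.
  rewrite hp /theta -kE invf_div; field.
  by rewrite addrC natr1 pnatr_eq0.
rewrite kE; set W := _ ^+ t + _; set k := _^-1.
have W0 : 0 <= W by rewrite addr_ge0 ?exprn_ge0 // mulr_ge0 // max_solutions_ge0.
(* The operator norm is an infimum, so it suffices that the claimed constant is admissible. *)
apply: ereal_inf_lbound; eexists; last reflexivity.
split=> [|f]; first by rewrite !mulr_ge0 ?powR_ge0 ?invr_ge0 // ltW.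
rewrite pE => hf; apply: ge_ereal_sup => _ [u /= u0 <-].
rewrite fine_inv_conjugate ?invr_gt0 // invrK [C * _]mulrC -mulrA.
apply: lorentz_weak_bound => //; first by rewrite mulr_ge0 ?powR_ge0 // ltW.
by move=> E F; apply: bound.
Qed.
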